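(* Let $r\ge1$ and let $G=\overline{\langle a_1,\dots,a_r\rangle}\subset W$ be the closed subgroup topologically generated by the elements $a_1,\dots,a_r\in W$ determined by $a_1=(a_r,1)\,\sigma$ and $a_i=(a_{i-1},1)$ for $2\le i\le r$. For any elements $b_1,\dots,b_r\in W$ the following are equivalent: (a) $b_1$ is conjugate to $(b_r,1)\,\sigma$ under $W$, and $b_i$ is conjugate to $(b_{i-1},1)$ under $W$ for any $2\le i\le r$. (b) $b_i$ is conjugate to $a_i$ under $W$ for any $1\le i\le r$. (c) There exist $w\in W$ and $x_1,\dots,x_r\in G$ such that $b_i=(wx_i)a_i(wx_i)^{-1}$ for any $1\le i\le r$. Moreover, for any $w$ as in (c), the closed subgroup of $W$ topologically generated by $b_1,\dots,b_r$ is equal to $wGw^{-1}$.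
   Context: $T$ is the infinite rooted binary tree whose vertices are the finite words over $\{0,1\}$, with root the empty word, each word $t$ being joined by an edge to $t0$ and $t1$. $W:=\operatorname{Aut}(T)$ is its automorphism group, a profinite group as the inverse limit of the finite groups $W_n=\operatorname{Aut}(T_n)$, where $T_n\subset T$ is the subtree of words of length $\le n$. For $u,v\in W$, $(u,v)\in W$ denotes the automorphism $0t\mapsto 0\,u(t)$, $1t\mapsto 1\,v(t)$ for all words $t$; $\sigma\in W$ is the automorphism of order $2$ with $0t\mapsto 1t$ and $1t\mapsto 0t$. Thus $W=(W\times W)\rtimes\langle\sigma\rangle$. The recursion relations for $a_1,\dots,a_r$ have a unique solution in $W$. *)

(* Defs.v *)
From HB Require Import structures.
From mathcomp Require Import all_boot.
From mathcomp Require Import boolp classical_sets topology.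

Set Implicit Arguments.
Unset Strict Implicit.
Unset Printing Implicit Defensive.

Local Open Scope classical_set_scope.
Local Open Scope group_scope.

(* Vertices of T; the letters 0 and 1 are [false] and [true]. *)
Notation word := (seq bool).

(* Children are obtained by appending a letter on the right. *)
Definition adj (s t : word) : bool :=
  [exists c : bool, (t == rcons s c) || (s == rcons t c)].

Record W : Type := MkW {
  wfun :> word -> word;
  winv : word -> word;
  wfunK : cancel wfun winv;
  winvK : cancel winv wfun;
  wfun_root : wfun [::] = [::];
  wfun_adj : forall s t, adj (wfun s) (wfun t) = adj s t }.

HB.instance Definition _ := gen_eqMixin W.
HB.instance Definition _ := gen_choiceMixin W.

Lemma W_ext (g h : W) : (forall t, g t = h t) -> g = h.
Proof.
case: g h => f f' fK f'K f0 fA [k k' kK k'K k0 kA] /= fk.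
have e : f = k by apply/funext.
subst k.
have e' : f' = k' by apply/funext => t; rewrite -{1}(k'K t) fK.
by subst k'; f_equal; apply: Prop_irrelevance.
Qed.

Definition W_one : W :=
  @MkW id id (fun=> erefl) (fun=> erefl) erefl (fun _ _ => erefl).

(* The product is composition: elements of W act on words from the left. *)
Program Definition W_mul (g h : W) : W :=
  @MkW (g \o h) (winv h \o winv g) _ _ _ _.
Next Obligation. by move=> g h; apply: can_comp; apply: wfunK. Qed.
Next Obligation. by move=> g h; apply: can_comp; apply: winvK. Qed.
Next Obligation. by move=> g h /=; rewrite !wfun_root. Qed.
Next Obligation. by move=> g h s t /=; rewrite !wfun_adj. Qed.

Program Definition W_inv (g : W) : W :=
  @MkW (winv g) g (@winvK g) (@wfunK g) _ _.
Next Obligation. by move=> g; rewrite -{1}(wfun_root g) wfunK. Qed.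
Next Obligation. by move=> g s t; rewrite -(wfun_adj g) !winvK. Qed.

Lemma W_mulA : associative W_mul.
Proof. by move=> f g h; apply: W_ext. Qed.
Lemma W_mul1g : left_id W_one W_mul.
Proof. by move=> g; apply: W_ext. Qed.
Lemma W_mulg1 : right_id W_one W_mul.
Proof. by move=> g; apply: W_ext. Qed.
Lemma W_mulVg : left_inverse W_one W_inv W_mul.
Proof. by move=> g; apply: W_ext => t /=; rewrite wfunK. Qed.
Lemma W_mulgV : right_inverse W_one W_inv W_mul.
Proof. by move=> g; apply: W_ext => t /=; rewrite winvK. Qed.

HB.instance Definition _ :=
  isGroup.Build W W_mulA W_mul1g W_mulg1 W_mulVg W_mulgV.

(* [g] and [h] have the same image in W_n = Aut(T_n). *)
Definition eq_level (n : nat) (g h : W) : Prop :=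
  forall t : word, size t <= n -> g t = h t.

(* The profinite topology of the inverse limit of the discrete groups W_n:
   the classes modulo the kernels of W -> W_n are a neighbourhood basis. *)
Definition W_nbhs (g : W) : set_system W :=
  [set A | exists n, [set h | eq_level n g h] `<=` A].

HB.instance Definition _ := hasNbhs.Build W W_nbhs.

Lemma W_nbhs_filter (g : W) : ProperFilter (nbhs g).
Proof.
split; first by case=> n /(_ g); apply.
split; first by exists 0%N.
  move=> A B [m mA] [n nB]; exists (maxn m n) => h gh; split.
    by apply: mA => t tm; apply: gh; rewrite leq_max tm.
  by apply: nB => t tn; apply: gh; rewrite leq_max tn orbT.
by move=> A B AB [n nA]; exists n; apply: subset_trans AB.
Qed.

Lemma W_nbhs_singleton (g : W) (A : set W) : nbhs g A -> A g.
Proof. by case=> n; apply. Qed.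

Lemma W_nbhs_nbhs (g : W) (A : set W) : nbhs g A -> nbhs g (nbhs^~ A).
Proof.
case=> n nA; exists n => h gh; exists n => k hk.
by apply: nA => t tn; rewrite gh // hk.
Qed.

HB.instance Definition _ :=
  Nbhs_isNbhsTopological.Build W W_nbhs_filter W_nbhs_singleton W_nbhs_nbhs.

Lemma adj_cons (c d : bool) (s t : word) :
  adj (c :: s) (d :: t) = (c == d) && adj s t.
Proof.
rewrite /adj; case: eqVneq => [<-|cd] /=.
  by apply: eq_existsb => e; rewrite !eqseq_cons eqxx.
apply/existsP => -[e]; rewrite !eqseq_cons (negPf cd).
by rewrite eq_sym (negPf cd).
Qed.

Lemma adj_nil_cons (c : bool) (t : word) : adj [::] (c :: t) = (t == [::]).
Proof.
apply/existsP/eqP => [[e]|->]; last by exists c; rewrite eqxx.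
by case: t => //= d t; rewrite eqseq_cons andbF.
Qed.

Lemma adjC (s t : word) : adj s t = adj t s.
Proof. by apply: eq_existsb => c; rewrite orbC. Qed.

Lemma wfun_eq0 (g : W) (t : word) : (g t == [::]) = (t == [::]).
Proof. by rewrite -{1}(wfun_root g) (can_eq (@wfunK g)). Qed.

Definition pair_fun (f k : word -> word) (t : word) : word :=
  if t is c :: t' then c :: (if c then k t' else f t') else [::].

(* The element (u, v) of W. *)
Program Definition wpair (u v : W) : W :=
  @MkW (pair_fun u v) (pair_fun (winv u) (winv v)) _ _ _ _.
Next Obligation. by move=> u v [|[] t] //=; rewrite wfunK. Qed.
Next Obligation. by move=> u v [|[] t] //=; rewrite winvK. Qed.
Next Obligation. by []. Qed.
Next Obligation.
move=> u v [|c s] [|d t] //=; rewrite ?adj_cons.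
- by rewrite !adj_nil_cons; case: d; rewrite wfun_eq0.
- by rewrite adjC [RHS]adjC !adj_nil_cons; case: c; rewrite wfun_eq0.
- by case: c d => -[] //=; rewrite wfun_adj.
Qed.

Definition flip_fun (t : word) : word :=
  if t is c :: t' then ~~ c :: t' else [::].

Program Definition sigma : W := @MkW flip_fun flip_fun _ _ _ _.
Next Obligation. by case=> [|[] t]. Qed.
Next Obligation. by case=> [|[] t]. Qed.
Next Obligation. by []. Qed.
Next Obligation.
case=> [|c s] [|d t] //=; rewrite ?adj_cons ?adj_nil_cons //.
- by rewrite adjC [RHS]adjC !adj_nil_cons.
- by case: c d => -[].
Qed.

Definition conjugate (g h : W) : Prop := exists w : W, g = w * h * w^-1.

(* The closed subgroup of W topologically generated by A. *)
Definition topgen (A : set W) : set W :=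
  closure (smallest [set H : set W | group_closed (mem H)] A).

(* The right-hand sides (c_r, 1) sigma and (c_(i-1), 1), 2 <= i <= r. The index
   i : 'I_r stands for i + 1, and [ord_pred] is the cyclic predecessor on 'I_r,
   which sends 0 to r - 1. *)
Definition rec_rhs (r : nat) (c : 'I_r -> W) (i : 'I_r) : W :=
  if i == 0 :> nat then wpair (c (ord_pred i)) 1 * sigma
  else wpair (c (ord_pred i)) 1.

Definition recursion (r : nat) (a : 'I_r -> W) : Prop :=
  forall i : 'I_r, a i = rec_rhs a i.

Section Existence.
Variable r : nat.

Fixpoint rec_fun (t : word) (i : 'I_r) : word :=
  if t is c :: t' then
    let d := (i == 0 :> nat) (+) c in
    d :: (if d then t' else rec_fun t' (ord_pred i))
  else [::].

Fixpoint rec_inv (t : word) (i : 'I_r) : word :=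
  if t is d :: t' then
    ((i == 0 :> nat) (+) d) :: (if d then t' else rec_inv t' (ord_pred i))
  else [::].

Lemma rec_funK (i : 'I_r) : cancel (rec_fun^~ i) (rec_inv^~ i).
Proof.
move=> t; elim: t i => //= c t IH i; rewrite addKb.
by case: (_ (+) c); rewrite ?IH.
Qed.

Lemma rec_invK (i : 'I_r) : cancel (rec_inv^~ i) (rec_fun^~ i).
Proof. by move=> t; elim: t i => //= -[] t IH i; rewrite addKb ?IH. Qed.

Lemma rec_fun_adj (i : 'I_r) (s t : word) :
  adj (rec_fun s i) (rec_fun t i) = adj s t.
Proof.
have nil0 (u : word) j : (rec_fun u j == [::]) = (u == [::]) by case: u.
elim: s t i => [|c s IH] [|d t] i //=; rewrite ?adj_cons ?adj_nil_cons //.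
- by case: ifP; rewrite ?nil0.
- by rewrite adjC [RHS]adjC !adj_nil_cons; case: ifP; rewrite ?nil0.
- rewrite (inj_eq (@addbI _)); case: eqVneq => //= <-.
  by case: ifP; rewrite ?IH.
Qed.

Definition rec_sol (i : 'I_r) : W :=
  @MkW (rec_fun^~ i) (rec_inv^~ i)
    (rec_funK i) (rec_invK i) erefl (rec_fun_adj i).

Lemma recursion_existence : recursion rec_sol.
Proof.
move=> i; rewrite /rec_rhs.
by case: ifP => i0; apply: W_ext => -[|c t] //=; rewrite i0.
Qed.

Lemma recursion_uniqueness (a b : 'I_r -> W) :
  recursion a -> recursion b -> a = b.
Proof.
move=> ra rb; apply/funext => i; apply: W_ext => t.
elim: t i => [|c t IH] i; first by rewrite !wfun_root.
by rewrite ra rb /rec_rhs; case: ifP => _; case: c => //=; rewrite IH.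
Qed.

End Existence.

(* Main.v *)
(* (a) <-> (b) follows by induction on the level, because conjugating the data of
   the recursion by w conjugates its right-hand sides by (w, 1) or (w, w), and a
   limit of conjugators modulo level n is a conjugator since W is compact.

   (b) -> (c): after a global conjugation b_1 = a_1 = (a_r, 1) sigma. For i >= 2
   some e in {1, a_1} conjugates b_i into (c_{i-1}, 1) with c_{i-1} conjugate to
   a_{i-1}; put c_r = a_r. The induction hypothesis for c modulo level n gives w
   and x_i, where one may take x_r = 1, so that (w, w) centralizes a_1 modulo
   level n + 1. As every x in <a_1, ..., a_r> is the first component of some
   (x, y) in this group, each b_i is conjugate to a_i by (w, w) times an element
   of it, modulo level n + 1. Then pass to the limit.

   For the last assertion take w = 1. The image of G in W_n is a finite 2-group,
   so its maximal subgroups are normal; one that contains x_i a_i x_i^-1 for all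
   i contains all a_i. Hence the b_i generate the image of G. *)

From mathcomp Require Import all_boot all_fingroup all_solvable.
From mathcomp Require Import boolp classical_sets topology.
Require Import Defs.

Set Implicit Arguments.
Unset Strict Implicit.

Local Open Scope classical_set_scope.
Local Open Scope group_scope.

(** * Tree automorphisms on words and the decomposition of W *)

Lemma adj_rcons (s t : word) (c : bool) :
  adj (rcons s c) t -> t = s \/ exists d, t = rcons (rcons s c) d.
Proof.
case/existsP => d /orP[/eqP ->|/eqP /rcons_inj[-> _]]; last by left.
by right; exists d.
Qed.

(** The image of a child of [t] is adjacent to [g t], and it is not the parent of [g t], which by
    induction is already the image of the parent of [t]. *)
Lemma wfun_rcons (g : W) (t : word) (c : bool) :
  exists d, g (rcons t c) = rcons (g t) d.
Proof.
have adj_g s e : adj (g s) (g (rcons s e)).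
  by rewrite wfun_adj; apply/existsP; exists e; rewrite eqxx.
elim/last_ind: t c => [|t c0 IH] c.
  have := adj_g [::] c; rewrite wfun_root => /existsP[d /orP[]/eqP].
    by exists d.
  by move/(congr1 size); rewrite size_rcons.
have := adj_g (rcons t c0) c; have [d ->] := IH c0.
case/adj_rcons => [/(can_inj (@wfunK g))/(congr1 size)|[e ->]].
  by rewrite !size_rcons => /eqP; rewrite -addn2 -{2}[size t]addn0 eqn_add2l.
by exists e.
Qed.

Lemma size_wfun (g : W) (t : word) : size (g t) = size t.
Proof.
elim/last_ind: t => [|t c IH]; first by rewrite wfun_root.
by have [d ->] := wfun_rcons g t c; rewrite !size_rcons IH.
Qed.

Lemma wfun_cons (g : W) (c : bool) (t : word) :
  g (c :: t) = head c (g [:: c]) :: behead (g (c :: t)).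
Proof.
elim/last_ind: t => [|t d IH].
  by have := size_wfun g [:: c]; case: (g [:: c]) => [|? []].
rewrite -rcons_cons; have [e ->] := wfun_rcons g (c :: t) d.
by rewrite IH.
Qed.

Section WSection.
Variables (g : W) (g_fix : forall c, g [:: c] = [:: c]) (c : bool).

Lemma wfun_fix_cons t : g (c :: t) = c :: behead (g (c :: t)).
Proof. by rewrite {1}wfun_cons g_fix. Qed.

Lemma winv_fix_cons t : winv g (c :: t) = c :: behead (winv g (c :: t)).
Proof.
by have := wfun_cons (W_inv g) c t; rewrite /= -{1}(g_fix c) wfunK.
Qed.

(** The section of [g] at the vertex [c]: its action on the subtree below [c], identified with T by
    removing the first letter. *)
Program Definition wsection : W :=
  @MkW (fun t => behead (g (c :: t))) (fun t => behead (winv g (c :: t)))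
    _ _ _ _.
Next Obligation. by move=> t; rewrite -wfun_fix_cons wfunK. Qed.
Next Obligation. by move=> t; rewrite -winv_fix_cons winvK. Qed.
Next Obligation. by rewrite /= g_fix. Qed.
Next Obligation.
move=> s t /=; have := wfun_adj g (c :: s) (c :: t).
by rewrite (wfun_fix_cons s) (wfun_fix_cons t) !adj_cons eqxx.
Qed.

End WSection.

Lemma wfix_pair (g : W) : (forall c, g [:: c] = [:: c]) ->
  exists u v, g = wpair u v.
Proof.
move=> g_fix; exists (wsection g_fix false), (wsection g_fix true).
apply: W_ext => -[|c t] /=; first by rewrite wfun_root.
by rewrite wfun_fix_cons //; case: c.
Qed.

Lemma W_mulE (g h : W) t : (g * h) t = g (h t). Proof. by []. Qed.

Lemma sigmaK : sigma * sigma = 1.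
Proof. by apply: W_ext => -[|[] t]. Qed.

Lemma wpairM u v u' v' : wpair u v * wpair u' v' = wpair (u * u') (v * v').
Proof. by apply: W_ext => -[|[] t]. Qed.

Lemma wpair1 : wpair 1 1 = 1.
Proof. by apply: W_ext => -[|[] t]. Qed.

Lemma wpairV u v : (wpair u v)^-1 = wpair u^-1 v^-1.
Proof. by apply: W_ext => -[|[] t]. Qed.

Lemma sigma_wpair u v : sigma * wpair u v = wpair v u * sigma.
Proof. by apply: W_ext => -[|[] t]. Qed.

(** One of [g] and [g * sigma] fixes both words of length one, hence is a pair. *)
Lemma wpair_sigma_cases (g : W) :
  exists u v, g = wpair u v \/ g = wpair u v * sigma.
Proof.
have inj := can_inj (@wfunK g).
have gc c : g [:: c] = [:: head c (g [:: c])].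
  by have := size_wfun g [:: c]; case: (g [:: c]) => [|? []].
have gft : head false (g [:: false]) <> head true (g [:: true]).
  move=> e; suff: [:: false] = [:: true] by [].
  by apply: inj; rewrite (gc false) e -gc.
case E: (head false (g [:: false])).
  have [|u [v guv]] := @wfix_pair (g * sigma).
    move=> c; rewrite W_mulE /= gc; move: gft.
    by case: c; rewrite /= E //; case: head.
  by exists u, v; right; rewrite -guv -mulgA sigmaK mulg1.
have [|u [v guv]] := @wfix_pair g; last by exists u, v; left.
by move=> c; rewrite gc; move: gft; case: c; rewrite /= E //; case: head.
Qed.

(** * Congruence modulo levels and closure *)

Section EqLevel.
Variable n : nat.
Implicit Types g h k : W.

Lemma eq_level_sym g h : eq_level n g h -> eq_level n h g.
Proof. by move=> gh t tn; rewrite gh. Qed.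

Lemma eq_level_trans h g k : eq_level n g h -> eq_level n h k -> eq_level n g k.
Proof. by move=> gh hk t tn; rewrite gh // hk. Qed.

Lemma eq_levelM g g' h h' :
  eq_level n g g' -> eq_level n h h' -> eq_level n (g * h) (g' * h').
Proof. by move=> gg' hh' t tn; rewrite !W_mulE hh' // gg' // size_wfun. Qed.

Lemma eq_levelV g g' : eq_level n g g' -> eq_level n g^-1 g'^-1.
Proof.
move=> gg' t tn; apply: (can_inj (@wfunK g)).
rewrite -W_mulE mulgV gg' ?size_wfun //.
by rewrite -W_mulE mulgV.
Qed.

Lemma eq_level_pair u v u' v' : eq_level n u u' -> eq_level n v v' ->
  eq_level n.+1 (wpair u v) (wpair u' v').
Proof. by move=> uu' vv' [|[] t] //= tn; rewrite ?uu' ?vv'. Qed.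

End EqLevel.

Lemma eq_level_le m n g h : (m <= n)%N -> eq_level n g h -> eq_level m g h.
Proof. by move=> mn gh t tm; apply: gh; apply: leq_trans mn. Qed.

Lemma eq_levelP (g h : W) : (forall n, eq_level n g h) <-> g = h.
Proof. by split=> [gh|-> //]; apply: W_ext => t; apply: (gh (size t)). Qed.

Lemma closureWP (A : set W) (g : W) :
  closure A g <-> forall n, exists2 h, A h & eq_level n g h.
Proof.
split=> [Ag n|Ag B [n nB]].
  by have [|h [Ah gh]] := Ag [set h | eq_level n g h];
    [exists n | exists h].
by have [h Ah gh] := Ag n; exists h; split=> //; apply: nB.
Qed.

(** * Subgroups and topological generation *)

Lemma group_closedP (H : set W) : group_closed (mem H) <->
  H 1 /\ forall x y, H x -> H y -> H (x * y^-1).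
Proof.
split=> -[H1 HM].
  by split=> [|x y Hx Hy]; [move: H1 | have := HM x y]; rewrite !inE; auto.
by split=> [|x y]; rewrite ?inE //; apply: HM.
Qed.

Section GroupClosed.
Variable (H : set W) (gH : group_closed (mem H)).

Lemma group_closed_setV x : H x -> H x^-1.
Proof.
by have /group_closedP[H1 HM] := gH; move/(HM _ _ H1); rewrite mul1g.
Qed.

Lemma group_closed_setM x y : H x -> H y -> H (x * y).
Proof.
have /group_closedP[H1 HM] := gH.
by move=> Hx /group_closed_setV; rewrite -{2}[y]invgK; apply: HM.
Qed.

Lemma group_closed_set1 : H 1.
Proof. by have /group_closedP[H1 HM] := gH. Qed.

Lemma closure_group_closed : group_closed (mem (closure H)).
Proof.
apply/group_closedP; split.
  by apply: subset_closure; apply: group_closed_set1.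
move=> x y /closureWP Hx /closureWP Hy; apply/closureWP => n.
have [x' Hx' xx'] := Hx n; have [y' Hy' yy'] := Hy n.
exists (x' * y'^-1).
  by apply: group_closed_setM => //; apply: group_closed_setV.
by apply: eq_levelM => //; apply: eq_levelV.
Qed.

End GroupClosed.

(** The abstract generated subgroup; [topgen A] is by definition its closure. *)
Definition gengroup (A : set W) : set W :=
  smallest [set H : set W | group_closed (mem H)] A.

Lemma gengroup_closed A : group_closed (mem (gengroup A)).
Proof.
apply/group_closedP; split=> [H [gH _]|x y Ax Ay H HA].
  exact: group_closed_set1.
have gH := HA.1; apply: group_closed_setM => //; first exact: Ax.
by apply: group_closed_setV => //; exact: Ay.
Qed.

Lemma sub_gengroup A : A `<=` gengroup A.
Proof. exact: sub_gen_smallest. Qed.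

Lemma gengroup_sub A (H : set W) :
  group_closed (mem H) -> A `<=` H -> gengroup A `<=` H.
Proof. by move=> gH AH; apply: smallest_sub. Qed.

Lemma topgen_closed A : closed (topgen A).
Proof. exact: closed_closure. Qed.

Lemma topgen_group_closed A : group_closed (mem (topgen A)).
Proof. by apply: closure_group_closed; apply: gengroup_closed. Qed.

Lemma gengroup_sub_topgen A : gengroup A `<=` topgen A.
Proof. exact: subset_closure. Qed.

Lemma topgen_sub A (H : set W) :
  group_closed (mem H) -> closed H -> A `<=` H -> topgen A `<=` H.
Proof.
move=> gH cH AH; rewrite /topgen closureE; apply: smallest_sub => //.
exact: gengroup_sub.
Qed.

Section Conjugation.
Variables (w : W) (H : set W).
Let Hw : set W := [set g | H (w * g * w^-1)].

Lemma group_closed_conj : group_closed (mem H) -> group_closed (mem Hw).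
Proof.
move=> gH; apply/group_closedP; split.
  by rewrite /Hw /= mulg1 mulgV; apply: group_closed_set1.
move=> x y; rewrite /Hw /= => Hx Hy.
have -> : w * (x * y^-1) * w^-1 = (w * x * w^-1) * (w * y * w^-1)^-1.
  by rewrite !invgM invgK !mulgA mulgKV.
by apply: group_closed_setM => //; apply: group_closed_setV.
Qed.

Lemma closed_conj : closed H -> closed Hw.
Proof.
move=> cH g /closureWP Hg; apply: cH; apply/closureWP => n.
have [h Hh gh] := Hg n; exists (w * h * w^-1) => //.
by do 2![apply: eq_levelM => //].
Qed.

End Conjugation.

(** * Compactness of W by ultrafilters *)

Lemma fin_ultra (T : Type) (U : set_system T) (UU : UltraFilter U)
    (S : finType) (f : T -> S) : exists s, U [set m | f m = s].
Proof.
apply: contrapT => no.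
have : U [set m | forall s, f m <> s].
  apply: filter_forall => s.
  have [Us|//] := in_ultra_setVsetC [set m | f m = s] UU.
  by case: no; exists s.
by case/filter_ex => m /(_ (f m)).
Qed.

(** At each word [f] takes finitely many values, so one of them is taken on a set of [U]; these
    values define the limit, and those of the inverses define its inverse. *)
Lemma ultra_limit (T : Type) (U : set_system T) (UU : UltraFilter U)
    (f : T -> W) : exists g, forall n, U [set m | eq_level n (f m) g].
Proof.
have lim (h : T -> W) (t : word) : exists s, U [set m | h m t = s].
  have ht m : (size (h m t) <= size t)%N by rewrite size_wfun.
  have [s Us] := fin_ultra UU (fun m => Bseq (ht m)).
  by exists s; apply: filterS Us => m /= /(congr1 val).
have [g gP] := choice (lim f).
have [g' g'P] := choice (lim (fun m => (f m)^-1)).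
have gK : cancel g g'.
  move=> t; have [m [/= <- <-]] := filter_ex (filterI (gP t) (g'P (g t))).
  exact: wfunK.
have g'K : cancel g' g.
  move=> t; have [m [/= <- <-]] := filter_ex (filterI (g'P t) (gP (g' t))).
  exact: winvK.
have g0 : g [::] = [::].
  by have [m /= <-] := filter_ex (gP [::]); apply: wfun_root.
have gA s t : adj (g s) (g t) = adj s t.
  have [m [/= <- <-]] := filter_ex (filterI (gP s) (gP t)).
  exact: wfun_adj.
exists (MkW gK g'K g0 gA) => n.
have : U [set m | forall t : n.-bseq bool, f m t = g t].
  by apply: filter_forall => t; apply: gP.
by apply: filterS => m /= fg t tn; apply: (fg (Bseq tn)).
Qed.

(** A single index [m] serves the whole finite family, and [n <= m] lets a congruence known modulo
    level [m] be used modulo level [n]. *)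
Lemma W_seq_limit (I : finType) (f : nat -> I -> W) :
  exists g : I -> W, forall n, exists2 m, (n <= m)%N &
    forall i, eq_level n (f m i) (g i).
Proof.
have [U [UU sU]] := ultraFilterLemma (F := \oo) _.
have /choice[g gP] i := ultra_limit UU (f^~ i).
exists g => n.
have : U [set m | (n <= m)%N /\ forall i, eq_level n (f m i) (g i)].
  apply: filterI; first by apply: sU; exists n.
  by apply: filter_forall => i; apply: gP.
by case/filter_ex => m [nm fg]; exists m.
Qed.

(** * Generators, conjugation and limits of conjugators *)

Lemma gengroup_gen I (f : I -> W) i : gengroup (range f) (f i).
Proof. by apply: sub_gengroup; exists i. Qed.

Lemma topgen_gen I (f : I -> W) i : topgen (range f) (f i).
Proof. by apply: gengroup_sub_topgen; apply: gengroup_gen. Qed.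

Definition conjl (w h : W) : W := w * h * w^-1.

Lemma conjl1 h : conjl 1 h = h.
Proof. by rewrite /conjl mul1g invg1 mulg1. Qed.

Lemma conjlM u v h : conjl (u * v) h = conjl u (conjl v h).
Proof. by rewrite /conjl invgM !mulgA. Qed.

Lemma conjl_wpair u v p q :
  conjl (wpair u v) (wpair p q) = wpair (conjl u p) (conjl v q).
Proof. by rewrite /conjl wpairV !wpairM. Qed.

(** A diagonal pair commutes with [sigma], so it acts on the pair alone. *)
Lemma conjl_wpair_sigma u p :
  conjl (wpair u u) (wpair p 1 * sigma) = wpair (conjl u p) 1 * sigma.
Proof.
rewrite /conjl wpairV -!mulgA sigma_wpair !mulgA !wpairM mulg1.
by rewrite mulgV.
Qed.

Lemma eq_level_conjl n w w' h h' :
  eq_level n w w' -> eq_level n h h' -> eq_level n (conjl w h) (conjl w' h').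
Proof.
by move=> ww' hh'; do 2?[apply: eq_levelM => //]; apply: eq_levelV.
Qed.

Lemma conjugate_sym g h : conjugate g h -> conjugate h g.
Proof.
by case=> w ->; exists w^-1; rewrite invgK !mulgA mulVg mul1g mulgKV.
Qed.

Lemma conjugate_trans h g k : conjugate g h -> conjugate h k -> conjugate g k.
Proof.
by move=> [w ->] [v ->]; exists (w * v); rewrite -!/(conjl _ _) conjlM.
Qed.

Lemma conjugate_of_levels (r : nat) (a b : 'I_r -> W) (H : set W) :
  closed H ->
  (forall n, exists w x, forall i, H (x i) /\
     eq_level n (b i) (conjl (w * x i) (a i))) ->
  exists w x, forall i, H (x i) /\ b i = conjl (w * x i) (a i).
Proof.
move=> cH /choice[w /choice[x xP]].
(* Packing [w] and all [x i] into one family gives a common index [m] for their limits. *)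
pose f n o := if o is Some i then x n i else w n.
have [g gP] := W_seq_limit f.
exists (g None), (fun i => g (Some i)) => i; split.
  apply: cH; apply/closureWP => n; have [m _ fg] := gP n.
  by exists (x m i); [have [] := xP m i | apply/eq_level_sym/(fg (Some i))].
apply/eq_levelP => n; have [m nm fg] := gP n.
apply: (eq_level_trans (eq_level_le nm (xP m i).2)).
apply: eq_level_conjl => //.
by apply: eq_levelM; [apply: (fg None) | apply: (fg (Some i))].
Qed.

(** * The recursion up to conjugacy *)

Section Recursion.
Variables (r : nat) (a : 'I_r -> W) (a_rec : recursion a).

Lemma rec_rhs_conj (b c : 'I_r -> W) i :
  conjugate (c (ord_pred i)) (b (ord_pred i)) ->
  conjugate (rec_rhs c i) (rec_rhs b i).
Proof.
move=> [w cb]; rewrite /rec_rhs; case: ifP => _; last first.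
  by exists (wpair w 1); rewrite -/(conjl _ _) conjl_wpair conjl1 cb.
by exists (wpair w w); rewrite -/(conjl _ _) conjl_wpair_sigma cb.
Qed.

(** Passing to pairs gains one level; this is the inductive step of [conjugate_rec]. *)
Lemma rec_rhs_level n (b : 'I_r -> W) i w :
  eq_level n (b (ord_pred i)) (conjl w (a (ord_pred i))) ->
  exists w', eq_level n.+1 (rec_rhs b i) (conjl w' (a i)).
Proof.
move=> ba; rewrite (a_rec i) /rec_rhs; case: ifP => _.
  exists (wpair w w); rewrite conjl_wpair_sigma; apply: eq_levelM => //.
  exact: eq_level_pair.
exists (wpair w 1); rewrite conjl_wpair conjl1; exact: eq_level_pair.
Qed.

Lemma conjugate_rec (b : 'I_r -> W) :
  (forall i, conjugate (b i) (rec_rhs b i)) -> forall i, conjugate (b i) (a i).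
Proof.
move=> b_rec.
have lev n i : exists w, eq_level n (b i) (conjl w (a i)).
  elim: n i => [|n IH] i.
    by exists 1; move=> [|//] _; rewrite !wfun_root.
  have [w /rec_rhs_level[w' bw']] := IH (ord_pred i).
  have [u ->] := b_rec i; exists (u * w').
  by rewrite conjlM; apply: eq_level_conjl.
(* With [w] = 1 at every level and all of W as the closed set, the conjugators for different [i] are
   unrelated. *)
have [|w [x xP]] := @conjugate_of_levels r a b setT closedT.
  move=> n; have [x xP] := choice (lev n).
  by exists 1, x => i; split=> //; rewrite mul1g.
by move=> i; exists (w * x i); have [] := xP i.
Qed.

Lemma rec_conjugate (b : 'I_r -> W) :
  (forall i, conjugate (b i) (a i)) -> forall i, conjugate (b i) (rec_rhs b i).
Proof.
move=> ba i; apply: conjugate_trans (ba i) _; rewrite (a_rec i).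
by apply: rec_rhs_conj; apply: conjugate_sym.
Qed.

(** * A common conjugator up to elements of the generated group *)

Let Gamma := gengroup (range a).
Let GammaG : group_closed (mem Gamma) := gengroup_closed (range a).

(** It suffices to treat generators: the one following [a i] is either (a_i, 1), or (a_i, 1) sigma,
    whose square is (a_i, a_i). *)
Lemma gengroup_wpair x : Gamma x -> exists y, Gamma (wpair x y).
Proof.
move: x; apply: gengroup_sub => [|_ [i _ <-]].
  apply/group_closedP; split.
    by exists 1; rewrite wpair1; apply: group_closed_set1.
  move=> x y [x' Hx] [y' Hy]; exists (x' * y'^-1); rewrite -wpairM -wpairV.
  exact: (group_closed_setM GammaG Hx (group_closed_setV GammaG Hy)).
have : Gamma (a (ordS i)) by apply: gengroup_gen.
rewrite (a_rec (ordS i)) /rec_rhs ordSK.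
case: ifP => _ Gi; last by exists 1.
exists (a i); have := group_closed_setM GammaG Gi Gi.
rewrite mulgA -(mulgA _ sigma) sigma_wpair mulgA wpairM -mulgA sigmaK.
by rewrite !mulg1 mul1g.
Qed.

(** The [x i] are kept in the abstract group, where [gengroup_wpair] lifts them one level; [b]
    varies in the induction, which is applied to a new tuple [c]. *)
Lemma semirigid_level (i0 : 'I_r) n (b : 'I_r -> W) : i0 = 0 :> nat ->
  (forall i, conjugate (b i) (a i)) ->
  exists w x, forall i, Gamma (x i) /\
    eq_level n (b i) (conjl (w * x i) (a i)).
Proof.
move=> i00; elim: n b => [|n IH] b ba.
  exists 1, (fun=> 1) => i; split; first exact: (group_closed_set1 GammaG).
  by move=> [|//] _; rewrite !wfun_root.
pose a0 := a i0; pose last := ord_pred i0.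
have a0E : a0 = wpair (a last) 1 * sigma by rewrite /a0 a_rec /rec_rhs i00.
have aE j : j != i0 -> a j = wpair (a (ord_pred j)) 1.
  by move=> j0; rewrite [LHS]a_rec /rec_rhs -i00 val_eqE (negPf j0).
have {ba}[v vP] := choice ba.
pose u := v i0.
(* Since [a0] swaps the two subtrees below the root, a factor 1 or [a0] makes the product a pair. *)
have epP j : exists ep : W * W, (ep.1 = 1 \/ ep.1 = a0) /\
    exists q, ep.1 * (u^-1 * v j) = wpair ep.2 q.
  have [p [q [->|->]]] := wpair_sigma_cases (u^-1 * v j).
    by exists (1, p); split; [left | exists q; rewrite mul1g].
  exists (a0, a last * q); split; [by right | exists p => /=].
  rewrite a0E mulgA -(mulgA _ sigma) sigma_wpair -!mulgA sigmaK mulg1 wpairM.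
  by rewrite mul1g.
have {epP}[ep epP] := choice epP.
pose e j := (ep j).1; pose p j := (ep j).2.
have e1 j : e j = 1 \/ e j = a0 by have [] := epP j.
(* The test [ordS i == i0] singles out [last]; keeping the entry of [a] there makes the induction
   hypothesis yield an approximate centralizer of [a last]. *)
pose c i := if ordS i == i0 then a i else conjl (p (ordS i)) (a i).
have [i|w [x xP]] := IH c.
  rewrite /c; case: ifP => _; last by exists (p (ordS i)).
  by exists 1; rewrite -/(conjl _ _) conjl1.
(* As [c last = a last], [w'] centralizes [a last] modulo level n, so [om] centralizes [a0] modulo
   level n + 1. *)
pose z := x last; pose w' := w * z; pose om := wpair w' w'.
have om0 : eq_level n.+1 a0 (conjl om a0).
  rewrite {2}a0E conjl_wpair_sigma {1}a0E; apply: eq_levelM => //.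
  apply: eq_level_pair => //; have [_] := xP last.
  by rewrite {1}/c ord_predK eqxx.
have ome j : eq_level n.+1 ((e j)^-1 * om) (om * (e j)^-1).
  have [->|->] := e1 j; first by rewrite invg1 mulg1 mul1g.
  have : eq_level n.+1 (a0^-1 * (a0 * om) * a0^-1)
                       (a0^-1 * (conjl om a0 * om) * a0^-1).
    by do 3?[apply: eq_levelM => //].
  rewrite /conjl mulgKV !mulgA mulVg mul1g mulgK => h.
  exact: eq_level_sym.
(* The factor [z^-1] is chosen so that [om * Y j] has first component [w * x (ord_pred j)]. *)
have yP j : exists y, Gamma (wpair (z^-1 * x (ord_pred j)) y).
  apply: gengroup_wpair; apply: (group_closed_setM GammaG).
    by apply: (group_closed_setV GammaG); have [] := xP last.
  by have [] := xP (ord_pred j).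
have {yP}[y yP] := choice yP.
pose Y j := wpair (z^-1 * x (ord_pred j)) (y j).
(* For [j] other than [i0], [(e j)^-1] undoes the normalization of [b j] and is moved past [om] by
   [ome]. *)
exists (u * om), (fun j => if j == i0 then 1 else (e j)^-1 * Y j) => j.
case: eqVneq => [->|j0]; split.
- exact: (group_closed_set1 GammaG).
- by rewrite mulg1 (vP i0) conjlM; apply: eq_level_conjl.
- apply: (group_closed_setM GammaG) (yP j); apply: (group_closed_setV GammaG).
  have [->|->] := e1 j; first exact: (group_closed_set1 GammaG).
  exact: gengroup_gen.
have [_ [q eq]] := epP j.
have vE : v j = u * (e j)^-1 * wpair (p j) q.
  by rewrite -eq !mulgA mulgKV mulgV mul1g.
have -> : b j = conjl (u * (e j)^-1) (wpair (c (ord_pred j)) 1).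
  rewrite (vP j) -/(conjl _ _) vE conjlM {1}(aE j j0) conjl_wpair.
  by rewrite /c ord_predK (negPf j0) /conjl mulg1 mulgV.
apply: (@eq_level_trans _ (conjl (u * (e j)^-1) (conjl (om * Y j) (a j)))).
  apply: eq_level_conjl => //; rewrite (aE j j0) wpairM conjl_wpair.
  apply: eq_level_pair; last by rewrite /conjl mulg1 mulgV.
  by rewrite mulgA mulgK; have [] := xP (ord_pred j).
rewrite -conjlM; apply: eq_level_conjl => //.
rewrite -!mulgA; apply: eq_levelM => //; rewrite !mulgA.
exact: eq_levelM (ome j) _.
Qed.

Lemma semirigid (b : 'I_r -> W) : (0 < r)%N ->
  (forall i, conjugate (b i) (a i)) ->
  exists w x, forall i, topgen (range a) (x i) /\
    b i = conjl (w * x i) (a i).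
Proof.
move=> r0 ba; apply: conjugate_of_levels; first exact: topgen_closed.
move=> n; have [//|w [x xP]] := @semirigid_level (Ordinal r0) n b _ ba.
exists w, x => i; have [Gx bx] := xP i; split=> //.
exact: gengroup_sub_topgen.
Qed.

End Recursion.

(** * Images in W_n as finite 2-groups *)

Lemma expg2n_level n (g : W) : eq_level n (g ^+ (2 ^ n)) 1.
Proof.
elim: n g => [|n IH] g; first by move=> [|//] _; rewrite !wfun_root.
have pairX u v k : wpair u v ^+ k = wpair (u ^+ k) (v ^+ k).
  by elim: k => [|k IHk]; rewrite ?expg0 ?wpair1 // !expgS IHk wpairM.
(* Every square is a pair, so each squaring gains one level. *)
have [u [v guv]] : exists u v, g ^+ 2 = wpair u v.
  have [u [v [->|->]]] := wpair_sigma_cases g; rewrite expgS expg1.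
    by exists (u * u), (v * v); rewrite wpairM.
  exists (u * v), (v * u).
  rewrite mulgA -(mulgA _ sigma) sigma_wpair !mulgA wpairM -mulgA sigmaK.
  by rewrite mulg1.
rewrite expnS expgM guv pairX -wpair1; exact: eq_level_pair.
Qed.

Section LevelPerm.
Variable n : nat.

Lemma winv_level_subproof (g : W) (t : n.-bseq bool) : (size (winv g t) <= n)%N.
Proof. by rewrite (size_wfun (W_inv g)) size_bseq. Qed.

(* Acting through inverses makes [level_perm] a homomorphism, since the product
   of permutations composes from left to right. *)
Definition level_act (g : W) (t : n.-bseq bool) : n.-bseq bool :=
  Bseq (winv_level_subproof g t).

Lemma level_act_inj g : injective (level_act g).
Proof. by move=> s t /(congr1 val) /(can_inj (@winvK g)) /val_inj. Qed.

Definition level_perm (g : W) : {perm n.-bseq bool} := perm (@level_act_inj g).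

Lemma level_permM g h : level_perm (g * h) = level_perm g * level_perm h.
Proof. by apply/permP => t; rewrite permM !permE; apply: val_inj. Qed.

Lemma level_perm1 : level_perm 1 = 1.
Proof. by apply/permP => t; rewrite perm1 permE; apply: val_inj. Qed.

Lemma level_permV g : level_perm g^-1 = (level_perm g)^-1.
Proof.
by apply: (mulgI (level_perm g)); rewrite -level_permM !mulgV level_perm1.
Qed.

Lemma level_permX g k : level_perm (g ^+ k) = level_perm g ^+ k.
Proof.
elim: k => [|k IH]; first by rewrite !expg0 level_perm1.
by rewrite !expgS level_permM IH.
Qed.

Lemma level_permP g h : level_perm g = level_perm h <-> eq_level n g h.
Proof.
split=> [/permP gh|gh].
  rewrite -(invgK g) -(invgK h); apply: eq_levelV => t tn.
  by have := gh (Bseq tn); rewrite !permE => /(congr1 val).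
apply/permP => t; rewrite !permE; apply: val_inj => /=.
exact: (eq_levelV gh) (size_bseq t).
Qed.

Definition level_image (A : set W) : {set {perm n.-bseq bool}} :=
  [set p : {perm n.-bseq bool} | `[< exists2 g, A g & level_perm g = p >]]%SET.

Lemma level_imageP A g :
  reflect (exists2 h, A h & eq_level n g h) (level_perm g \in level_image A).
Proof.
apply: (iffP idP); rewrite inE.
  by case/asboolP=> h Ah /level_permP gh; exists h => //; apply: eq_level_sym.
case=> h Ah gh; apply/asboolP; exists h => //.
by apply/level_permP/eq_level_sym.
Qed.

Lemma level_image_group A : group_closed (mem A) -> group_set (level_image A).
Proof.
move=> gA; apply/group_setP; split.
  rewrite -level_perm1; apply/level_imageP; exists 1 => //.
  exact: (group_closed_set1 gA).
move=> p q; rewrite !inE => -[g Ag <-] [h Ah <-].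
exists (g * h); last exact: level_permM.
exact: (group_closed_setM gA).
Qed.

Lemma level_preim_group (M : {group {perm n.-bseq bool}}) :
  group_closed (mem [set g | level_perm g \in M]).
Proof.
apply/group_closedP; split=> [|x y] /=; first by rewrite level_perm1 group1.
by move=> Mx My; rewrite level_permM level_permV groupM ?groupV.
Qed.

(** An element of prime order p, given by Cauchy's theorem, has order dividing 2^n by
    [expg2n_level], so p = 2. *)
Lemma level_image_pgroup A (gA : group_closed (mem A)) :
  2.-group (group (level_image_group gA)).
Proof.
apply/pgroupP => p p_pr /(Cauchy p_pr)[x /= Ax xp].
move: Ax; rewrite inE => /asboolP[g _ gx].
have : x ^+ (2 ^ n) = 1.
  by rewrite -gx -level_permX -level_perm1; apply/level_permP/expg2n_level.
move/eqP; rewrite -order_dvdn xp Euclid_dvdX // => /andP[+ _].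
by rewrite dvdn_prime2.
Qed.

End LevelPerm.

(** * Generation by conjugates of the generators *)

Lemma conj_generators (r : nat) (a x : 'I_r -> W) :
  (forall i, topgen (range a) (x i)) ->
  forall i, topgen (range (fun j => conjl (x j) (a j))) (a i).
Proof.
pose d j := conjl (x j) (a j); rewrite -/d; move=> xG i; apply/closureWP => n.
pose gA := gengroup_closed (range a); pose gD := gengroup_closed (range d).
pose P := group (level_image_group n gA).
pose H := group (level_image_group n gD).
have aP j : level_perm n (a j) \in P.
  by apply/level_imageP; exists (a j) => //; apply: gengroup_gen.
(* Although [x j] is only in the closure, modulo level [n] it agrees with an element of the abstract
   group. *)
have xP j : level_perm n (x j) \in P.
  by apply/level_imageP; have /closureWP := xG j; apply.
have preim (A : set W) (M : {group {perm n.-bseq bool}}) :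
    (forall g, A g -> level_perm n g \in M) ->
    level_image n (gengroup A) \subset M.
  move=> AM; apply/fintype.subsetP => p; rewrite inE => /asboolP[g Ag <-].
  exact: gengroup_sub (level_preim_group M) AM g Ag.
have HP : H \subset P.
  apply: preim => _ [j _ <-].
  by rewrite /d /conjl !level_permM level_permV !groupM ?groupV.
(* If [H] is not all of [P], it lies in a maximal subgroup [M], which is then shown to contain
   [P]. *)
have [HPE|[M maxM HM]] := maximal_exists HP.
  by apply/level_imageP; rewrite -[level_image _ _]/(gval H) HPE.
have nM := p_maximal_normal (level_image_pgroup n gA) maxM.
have : P \subset M.
  apply: preim => _ [j _ <-].
  have : level_perm n (d j) \in M.
    apply: (fintype.subsetP HM); apply/level_imageP; exists (d j) => //.
    exact: gengroup_gen.
  have xN : level_perm n (x j) \in 'N(M).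
    exact: (fintype.subsetP (normal_norm nM)).
  (* Conjugation by [x j], which normalizes [M], turns [d j] back into [a j]. *)
  rewrite -(memJ_norm _ xN) /d /conjl !level_permM level_permV /conjg.
  by rewrite !mulgA mulVg mul1g mulgKV.
by rewrite (negPf (proper_subn (maxgroupp maxM))).
Qed.

(** * The equivalences and the closed subgroup generated by the [b i] *)

Theorem theorem2p4p1 (r : nat) (r_ge1 : (1 <= r)%N)
    (a : 'I_r -> W) (a_rec : recursion a) (b : 'I_r -> W) :
  let G : set W := topgen (range a) in
  let cond_a := forall i : 'I_r, conjugate (b i) (rec_rhs b i) in
  let cond_b := forall i : 'I_r, conjugate (b i) (a i) in
  let cond_c_for (w : W) := exists x : 'I_r -> W,
    forall i : 'I_r, G (x i) /\ b i = (w * x i) * a i * (w * x i)^-1 in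
  let cond_c := exists w : W, cond_c_for w in
  [/\ cond_a <-> cond_b, cond_b <-> cond_c
    & forall w : W, cond_c_for w ->
        topgen (range b) = [set w * g * w^-1 | g in G]].
Proof.
move=> G cond_a cond_b cond_c_for cond_c; split.
- by split; [apply: conjugate_rec | apply: rec_conjugate].
- split=> [/(semirigid a_rec r_ge1)//|[w [x xP]] i].
  by exists (w * x i); have [] := xP i.
move=> w [x xP]; have gG := topgen_group_closed (range a).
have cG : closed G := @topgen_closed (range a).
have gB := topgen_group_closed (range b).
have cB := @topgen_closed (range b).
have bE i : conjl w (conjl (x i) (a i)) = b i.
  by rewrite -conjlM; have [] := xP i.
rewrite eqEsubset; split.
  (* The right side is the closed subgroup w G w^-1, so it suffices that each w^-1 b_i w = x_i a_i
     x_i^-1 lies in [G]. *)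
  have sub : topgen (range b) `<=` [set g | G (w^-1 * g * w^-1^-1)].
    apply: topgen_sub; [exact: group_closed_conj|exact: closed_conj|].
    move=> _ [i _ <-] /=; have [Gx _] := xP i.
    rewrite -bE -/(conjl _ _) -conjlM mulVg conjl1.
    apply: (group_closed_setM gG); last exact: (group_closed_setV gG).
    apply: (group_closed_setM gG) => //.
    exact: topgen_gen.
  move=> g /sub Gg; exists (w^-1 * g * w^-1^-1) => //.
  by rewrite invgK !mulgA mulgV mul1g mulgK.
move=> _ [g Gg <-].
suff sub : G `<=` [set g | topgen (range b) (w * g * w^-1)] by apply: sub.
apply: topgen_sub; [exact: group_closed_conj|exact: closed_conj|].
move=> _ [i _ <-].
(* Each a_i lies in the closed subgroup generated by the x_j a_j x_j^-1, whose conjugates by [w] are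
   the b_j. *)
have /conj_generators ai j : topgen (range a) (x j) by have [] := xP j.
apply: topgen_sub (ai i).
- exact: group_closed_conj.
- exact: closed_conj.
- by move=> _ [j _ <-]; rewrite /= -/(conjl _ _) bE; apply: topgen_gen.
Qed.
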